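(* Let $(P,0,1,\oplus)$ be an orthoalgebra for which the tensor product $P\otimes P$ (in the category of orthoalgebras) exists. Then $P$ has the cloning property if and only if $P$ is a Boolean algebra.
   Context: **Orthoalgebra.** A quadruple $(P,0,1,\oplus)$ where $P$ is a set with two special elements $0,1$ and $\oplus$ is a partially defined binary operation (write $p\perp q$ when $p\oplus q$ is defined) such that for all $p,q,r\in P$: (i) if $p\perp q$ then $q\perp p$ and $p\oplus q=q\oplus p$; (ii) if $q\perp r$ and $p\perp(q\oplus r)$, then $p\perp q$, $(p\oplus q)\perp r$ and $p\oplus(q\oplus r)=(p\oplus q)\oplus r$; (iii) for every $p\in P$ there is a unique $q\in P$ with $p\perp q$ and $p\oplus q=1$; this $q$ is denoted $p'$; (iv) if $p\perp p$ then $p=0$. **Order.** $p\le q$ means there is $r\in P$ with $p\perp r$ and $q=p\oplus r$. This is a partial order with least element $0$ and greatest element $1$; $\vee,\wedge$ denote least upper and greatest lower bounds when they exist. **Boolean algebra.** An orthoalgebra $P$ is called a Boolean algebra if the bounded poset $(P,\le,0,1)$ is a distributive lattice in which $p'$ is a complement of $p$ for every $p$ (i.e. $p\wedge p'=0$ and $p\vee p'=1$). **Morphism.** A map $\phi:P_1\to P_2$ between orthoalgebras such that $p\perp q$ implies $\phi(p)\perp\phi(q)$ and $\phi(p\oplus q)=\phi(p)\oplus\phi(q)$, and $\phi(1)=1$. **Bimorphism.** For orthoalgebras $P,Q,L$, a map $\beta:P\times Q\to L$ such that: if $a\perp b$ in $P$ and $q\in Q$, then $\beta(a,q)\perp\beta(b,q)$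 and $\beta(a\oplus b,q)=\beta(a,q)\oplus\beta(b,q)$; if $c\perp d$ in $Q$ and $p\in P$, then $\beta(p,c)\perp\beta(p,d)$ and $\beta(p,c\oplus d)=\beta(p,c)\oplus\beta(p,d)$; and $\beta(1,1)=1$. **Tensor product.** A tensor product of orthoalgebras $P,Q$ is a pair $(T,\tau)$ with $T$ an orthoalgebra and $\tau:P\times Q\to T$ a bimorphism such that: (i) for every orthoalgebra $L$ and every bimorphism $\beta:P\times Q\to L$ there is a morphism $\alpha:T\to L$ with $\beta=\alpha\circ\tau$; (ii) every element of $T$ is a finite orthogonal sum (a defined iterated $\oplus$) of elements of the form $\tau(p,q)$. One writes $P\otimes Q$ for $T$ and $p\otimes q$ for $\tau(p,q)$. **Cloning property.** A cloning map on $P$ is a morphism $\phi:P\otimes P\to P$ with $\phi(p\otimes 1)=p$ and $\phi(1\otimes p)=p$ for all $p\in P$. $P$ has the cloning property if a cloning map $\phi:P\otimes P\to P$ exists. *)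

(* Defs.v *)
From mathcomp Require Import all_boot.

Set Implicit Arguments.
Unset Strict Implicit.
Unset Printing Implicit Defensive.

(* The partial operation is option-valued: [oplus p q = Some r] reads
   "p is orthogonal to q and r is their orthogonal sum".
   The trivial algebra, with zero = one, is not excluded. *)
Record orthoalgebra : Type := Orthoalgebra {
  oa_sort :> Type;
  zero : oa_sort;
  one : oa_sort;
  oplus : oa_sort -> oa_sort -> option oa_sort;
  oplusC : forall p q r, oplus p q = Some r -> oplus q p = Some r;
  oplusA : forall p q r qr s,
    oplus q r = Some qr -> oplus p qr = Some s ->
    exists2 pq, oplus p q = Some pq & oplus pq r = Some s;
  oplus_compl : forall p, exists! q, oplus p q = Some one;
  oplus_self : forall p, (exists r, oplus p p = Some r) -> p = zero
}.

Arguments zero {_}.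
Arguments one {_}.
Arguments oplus {_} p q.

Section Order.
Variable P : orthoalgebra.
Implicit Types p q r : P.

(* By the axiom [oplus_compl], [is_compl p q] says that q is p'. *)
Definition is_compl p q : Prop := oplus p q = Some one.

Definition oa_le p q : Prop := exists r, oplus p r = Some q.

Definition is_meet p q m : Prop :=
  [/\ oa_le m p, oa_le m q & forall r, oa_le r p -> oa_le r q -> oa_le r m].

Definition is_join p q j : Prop :=
  [/\ oa_le p j, oa_le q j & forall r, oa_le p r -> oa_le q r -> oa_le j r].

Definition is_lattice : Prop :=
  forall p q, (exists m, is_meet p q m) /\ (exists j, is_join p q j).

(* p /\ (q \/ r) = (p /\ q) \/ (p /\ r), for meets and joins given as
   relations. *)
Definition is_distributive : Prop :=
  forall p q r qr m pq pr,
    is_join q r qr -> is_meet p qr m ->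
    is_meet p q pq -> is_meet p r pr -> is_join pq pr m.

Definition is_boolean : Prop :=
  [/\ is_lattice,
      is_distributive &
      forall p p', is_compl p p' -> is_meet p p' zero /\ is_join p p' one].

(* The iterated sum of a sequence, [None] when it is undefined. *)
Definition orthosum (s : seq P) : option P :=
  foldr (fun p => obind (oplus p)) (Some zero) s.

End Order.

Definition is_morphism (P1 P2 : orthoalgebra) (phi : P1 -> P2) : Prop :=
  (forall p q r, oplus p q = Some r -> oplus (phi p) (phi q) = Some (phi r)) /\
  phi one = one.

Definition is_bimorphism (P Q L : orthoalgebra) (beta : P -> Q -> L) : Prop :=
  [/\ forall a b ab q, oplus a b = Some ab ->
        oplus (beta a q) (beta b q) = Some (beta ab q),
      forall c d cd p, oplus c d = Some cd ->
        oplus (beta p c) (beta p d) = Some (beta p cd) &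
      beta one one = one].

Definition is_tensor (P Q T : orthoalgebra) (tau : P -> Q -> T) : Prop :=
  [/\ is_bimorphism tau,
      forall (L : orthoalgebra) (beta : P -> Q -> L), is_bimorphism beta ->
        exists2 alpha : T -> L,
          is_morphism alpha & forall p q, beta p q = alpha (tau p q) &
      forall t : T, exists s : seq (P * Q),
        orthosum [seq tau x.1 x.2 | x <- s] = Some t].

Definition is_cloning_map (P T : orthoalgebra) (tau : P -> P -> T)
    (phi : T -> P) : Prop :=
  [/\ is_morphism phi,
      forall p, phi (tau p one) = p &
      forall p, phi (tau one p) = p].

(* Meaningful when (T, tau) is a tensor product of P with itself. *)
Definition cloning_property (P T : orthoalgebra) (tau : P -> P -> T) : Prop :=
  exists phi : T -> P, is_cloning_map tau phi.

(* Main.v *)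
From mathcomp Require Import all_boot.
From Stdlib Require Import IndefiniteDescription.
Require Import Defs.

Set Implicit Arguments.
Unset Strict Implicit.
Unset Printing Implicit Defensive.

(** Composing a cloning map with [tau] gives a bimorphism [P -> P -> P] with
    unit [one], and every bimorphism with unit [one] is a meet operation: it
    lies below both arguments, so it vanishes on orthogonal pairs, hence
    [r . p = r] for [r <= p].  The join of [q] and [r] is then
    [q (+) r . q'], and additivity of the product yields distributivity.
    Conversely, in a Boolean algebra orthogonal sums are joins, so by
    distributivity the meet is a bimorphism, and it factors through [T]. *)

(** * Cancellation and order in an orthoalgebra *)

Section Orthoalgebra.
Variable P : orthoalgebra.
Implicit Types p q r s : P.

Lemma compl_ex p : exists q, is_compl p q.
Proof. by have [q [pq _]] := oplus_compl p; exists q. Qed.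

Lemma compl_uniq p q r : is_compl p q -> is_compl p r -> q = r.
Proof. by have [x [_ ux]] := oplus_compl p; move=> /ux <- /ux <-. Qed.

Lemma compl_sym p q : is_compl p q -> is_compl q p.
Proof. exact: oplusC. Qed.

Lemma oplusAl p q r pq s :
  oplus p q = Some pq -> oplus pq r = Some s ->
  exists2 qr, oplus q r = Some qr & oplus p qr = Some s.
Proof.
move=> /oplusC qp /oplusC rpq.
have [x /oplusC qr /oplusC xp] := oplusA qp rpq.
by exists x.
Qed.

(** If [q] complements [one], then [one = q (+) one = q (+) (q (+) one)], so [q] is orthogonal to
    itself. *)
Lemma compl1_0 : is_compl (one : P) zero.
Proof.
have [q h1] := compl_ex one.
have [x qq _] := oplusA (compl_sym h1) (compl_sym h1).
by rewrite -(oplus_self (ex_intro _ x qq)).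
Qed.

Lemma oplus0l p : oplus zero p = Some p.
Proof.
have [q pq] := compl_ex p.
have [x h0p xq] := oplusA pq (oplusC compl1_0).
by rewrite h0p (compl_uniq (compl_sym pq) (oplusC xq)).
Qed.

Lemma oplus0r p : oplus p zero = Some p.
Proof. exact/oplusC/oplus0l. Qed.

(** With [t] the complement of [s], both [q] and [r] are complements of [t (+) p]. *)
Lemma oplusI p q r s : oplus p q = Some s -> oplus p r = Some s -> q = r.
Proof.
move=> pq pr; have [t /oplusC st] := compl_ex s.
have [x tp xq] := oplusA pq st; have [y tp' yr] := oplusA pr st.
by move: tp' yr; rewrite tp => -[<-] yr; apply: compl_uniq xq yr.
Qed.

Lemma orth1 p s : oplus p one = Some s -> p = zero.
Proof.
move=> p1; have [q pq] := compl_ex p.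
by have [x pp _] := oplusA pq p1; apply: oplus_self; exists x.
Qed.

Lemma oplus_eq0 p q : oplus p q = Some zero -> p = zero.
Proof.
by move=> pq; have [x /oplusC/orth1 ->] := oplusA pq compl1_0.
Qed.

Lemma oa_le_refl p : oa_le p p.
Proof. by exists zero; apply: oplus0r. Qed.

Lemma oa_le_trans q p r : oa_le p q -> oa_le q r -> oa_le p r.
Proof. by move=> [x px] [y qy]; have [z _ ?] := oplusAl px qy; exists z. Qed.

Lemma oa_le_anti p q : oa_le p q -> oa_le q p -> p = q.
Proof.
move=> [x px] [y qy]; have [z xy pz] := oplusAl px qy.
rewrite (oplusI pz (oplus0r p)) in xy.
by move: px; rewrite (oplus_eq0 xy) oplus0r => -[].
Qed.

Lemma oa_le1 p : oa_le p one.
Proof. by have [q ?] := compl_ex p; exists q. Qed.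

Lemma oplus_lel p q s : oplus p q = Some s -> oa_le p s.
Proof. by exists q. Qed.

Lemma oplus_ler p q s : oplus p q = Some s -> oa_le q s.
Proof. by move=> /oplusC; apply: oplus_lel. Qed.

Lemma oplus_mono_l p q a s : oa_le a p -> oplus p q = Some s ->
  exists2 t, oplus a q = Some t & oa_le t s.
Proof.
move=> [c /oplusC ca] pq; have [t aq ct] := oplusAl ca pq.
by exists t => //; apply: oplus_ler ct.
Qed.

Lemma oplus_mono p q a b s : oa_le a p -> oa_le b q -> oplus p q = Some s ->
  exists2 t, oplus a b = Some t & oa_le t s.
Proof.
move=> ap bq pq; have [t /oplusC aq ts] := oplus_mono_l ap pq.
have [u /oplusC ab ut] := oplus_mono_l bq aq.
by exists u => //; apply: oa_le_trans ts.
Qed.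

(** With [t] the complement of [s], [q' = p (+) t]. *)
Lemma orth_le_compl p q q' s :
  is_compl q q' -> oplus p q = Some s -> oa_le p q'.
Proof.
move=> qq' /oplusC qp; have [t st] := compl_ex s.
have [x px qx] := oplusAl qp st.
by rewrite (compl_uniq qq' qx); apply: oplus_lel px.
Qed.

Lemma orth_lower0 p q r s :
  oplus p q = Some s -> oa_le r p -> oa_le r q -> r = zero.
Proof.
move=> pq rp rq; have [t rr _] := oplus_mono rp rq pq.
by apply: oplus_self; exists t.
Qed.

Lemma is_meet_uniq p q m n : is_meet p q m -> is_meet p q n -> m = n.
Proof. by move=> [a b c] [d e f]; apply: oa_le_anti; auto. Qed.

Lemma is_join_uniq p q i j : is_join p q i -> is_join p q j -> i = j.
Proof. by move=> [a b c] [d e f]; apply: oa_le_anti; auto. Qed.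

(* An orthogonal sum is always a minimal upper bound of its terms. *)
Lemma oplus_join p q s j : oplus p q = Some s -> is_join p q j -> j = s.
Proof.
move=> pq [[x px] qj jP].
have [y jy] := jP s (oplus_lel pq) (oplus_ler pq).
(* Cancelling [p] in [s = p (+) (x (+) y)] gives [q = x (+) y]. So [y] is below [q], hence below
   [j], to which it is orthogonal: [y] is zero. *)
have [z xy pz] := oplusAl px jy.
have zq := oplusI pz pq.
have yq : oa_le y q by rewrite -zq; apply: oplus_ler xy.
have y0 := orth_lower0 jy (oa_le_trans yq qj) (oa_le_refl y).
by move: jy; rewrite y0 oplus0r => -[].
Qed.

End Orthoalgebra.

(** * Bimorphisms with unit [one] *)

Section UnitalBimorphism.
Variables (P : orthoalgebra) (mul : P -> P -> P).
Hypothesis mul_bimorphism : is_bimorphism mul.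
Hypothesis mulr1 : forall p, mul p one = p.
Hypothesis mul1r : forall p, mul one p = p.
Implicit Types p q r s : P.

Lemma mulDl p q s r :
  oplus p q = Some s -> oplus (mul p r) (mul q r) = Some (mul s r).
Proof. by case: mul_bimorphism => + _ _; apply. Qed.

Lemma mulDr p q s r :
  oplus p q = Some s -> oplus (mul r p) (mul r q) = Some (mul r s).
Proof. by case: mul_bimorphism => _ + _; apply. Qed.

Lemma mul_lel p q r : oa_le p q -> oa_le (mul p r) (mul q r).
Proof. by move=> [x /(mulDl r)]; apply: oplus_lel. Qed.

Lemma mul_ler p q r : oa_le p q -> oa_le (mul r p) (mul r q).
Proof. by move=> [x /(mulDr r)]; apply: oplus_lel. Qed.

Lemma mul_le1 p q : oa_le (mul p q) p.
Proof. by rewrite -{2}(mulr1 p); apply/mul_ler/oa_le1. Qed.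

Lemma mul_le2 p q : oa_le (mul p q) q.
Proof. by rewrite -{2}(mul1r q); apply/mul_lel/oa_le1. Qed.

Lemma mul_orth p q s : oplus p q = Some s -> mul p q = zero.
Proof. by move=> /orth_lower0; apply; [apply: mul_le1|apply: mul_le2]. Qed.

Lemma mul_idl p q : oa_le p q -> mul p q = p.
Proof.
have [q' qq'] := compl_ex q.
move=> pq; have [s pq' _] := oplus_mono_l pq qq'.
(* [p = p . one = p . q (+) p . q'], where the last term vanishes. *)
by have := mulDr p qq'; rewrite mulr1 (mul_orth pq') oplus0r => -[].
Qed.

Lemma mul_meet p q : is_meet p q (mul p q).
Proof.
split; [exact: mul_le1|exact: mul_le2|move=> r rp rq].
(* [r = r . r <= p . r <= p . q]. *)
rewrite -(mul_idl (oa_le_refl r)).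
exact: oa_le_trans (mul_lel r rp) (mul_ler p rq).
Qed.

Lemma mul_join p p' q : is_compl p p' ->
  exists2 j, oplus p (mul q p') = Some j & is_join p q j.
Proof.
move=> pp'.
have [j pj _] := oplus_mono (oa_le_refl p) (mul_le2 q p') pp'.
exists j => //; split; first exact: oplus_lel pj.
  (* [q = q . p (+) q . p' <= p (+) q . p' = j]. *)
  have := mulDr q pp'; rewrite mulr1 => qpp'.
  have [t] := oplus_mono (mul_le2 q p) (oa_le_refl (mul q p')) pj.
  by rewrite qpp' => -[<-].
move=> u [x px] qu.
(* Multiplying [u = p (+) x] by [p'] kills [p] and fixes [x]; hence [q . p' <= u . p' = x] and
   [j <= p (+) x = u]. *)
have xp' : oa_le x p' by apply: orth_le_compl pp' (oplusC px).
have up' : mul u p' = x.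
  by have := mulDl p' px; rewrite (mul_orth pp') (mul_idl xp') oplus0l => -[].
have qx : oa_le (mul q p') x by rewrite -up'; apply: mul_lel.
have [t] := oplus_mono (oa_le_refl p) qx px.
by rewrite pj => -[<-].
Qed.

Lemma unital_bimorphism_lattice : is_lattice P.
Proof.
move=> p q; split; first by exists (mul p q); apply: mul_meet.
by have [p' /(mul_join q)[j _ ?]] := compl_ex p; exists j.
Qed.

Lemma unital_bimorphism_distributive : is_distributive P.
Proof.
move=> p q r qr m pq pr jqr mpqr mpq mpr.
have [q' qq'] := compl_ex q.
have [j qj jP] := mul_join r qq'.
have [qqr rqr _] := jqr.
rewrite (is_join_uniq jP jqr) in qj.
rewrite (is_meet_uniq mpqr (mul_meet _ _)).
rewrite (is_meet_uniq mpq (mul_meet _ _)) (is_meet_uniq mpr (mul_meet _ _)).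
split; try exact: mul_ler.
move=> u pqu pru.
(* By additivity [p . qr] is the sum of [p . q] and [p . (r . q')], and this sum is their join since
   a join exists. Both terms lie below [u]. *)
have [_ [k kP]] := unital_bimorphism_lattice (mul p q) (mul p (mul r q')).
rewrite -(oplus_join (mulDr p qj) kP); have [_ _] := kP; apply=> //.
exact: oa_le_trans (mul_ler p (mul_le1 r q')) pru.
Qed.

Lemma unital_bimorphism_boolean : is_boolean P.
Proof.
split; [exact: unital_bimorphism_lattice|exact: unital_bimorphism_distributive|].
move=> p p' pp'; split; first by rewrite -(mul_orth pp'); apply: mul_meet.
have [_ [j jP]] := unital_bimorphism_lattice p p'.
by rewrite -(oplus_join pp' jP).
Qed.

End UnitalBimorphism.

(** * Bimorphisms and the meet of a Boolean algebra *)

Lemma bimorphism_comp (P Q T L : orthoalgebra) (tau : P -> Q -> T)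
    (phi : T -> L) :
  is_bimorphism tau -> is_morphism phi ->
  is_bimorphism (fun p q => phi (tau p q)).
Proof.
move=> [tauDl tauDr tau1] [phiD phi1]; split; last by rewrite tau1.
- by move=> a b ab q /(tauDl a b ab q)/phiD.
- by move=> c d cd p /(tauDr c d cd p)/phiD.
Qed.

Lemma meet_comm (P : orthoalgebra) (p q m : P) : is_meet p q m -> is_meet q p m.
Proof. by move=> [a b c]; split; auto. Qed.

(** Distributivity makes [m] the join of [aq] and [bq]. These are orthogonal, lying below [a] and
    [b], so their sum is that join. *)
Lemma boolean_meet_oplus (P : orthoalgebra) (a b ab q aq bq m : P) :
  is_boolean P -> oplus a b = Some ab ->
  is_meet q a aq -> is_meet q b bq -> is_meet q ab m ->
  oplus aq bq = Some m.
Proof.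
move=> [lat dist _] hab haq hbq hm.
have [_ [j jP]] := lat a b.
rewrite -(oplus_join hab jP) in hm.
have mP := dist _ _ _ _ _ _ _ jP hm haq hbq.
have [[_ aqa _] [_ bqb _]] := (haq, hbq).
have [t aqbq _] := oplus_mono aqa bqb hab.
by rewrite aqbq (oplus_join aqbq mP).
Qed.

Lemma boolean_meet_bimorphism (P : orthoalgebra) (meet : P -> P -> P) :
  is_boolean P -> (forall p q, is_meet p q (meet p q)) -> is_bimorphism meet.
Proof.
move=> bP meetP; split.
- move=> a b ab q hab.
  by apply: (boolean_meet_oplus bP hab); apply: meet_comm.
- by move=> c d cd p hcd; apply: (boolean_meet_oplus bP hcd).
- have [_ _ h] := meetP one one.
  by apply: oa_le_anti; [apply: oa_le1|apply: h; apply: oa_le_refl].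
Qed.

Theorem theorem1 (P T : orthoalgebra) (tau : P -> P -> T)
  (hT : is_tensor tau) :
  cloning_property tau <-> is_boolean P.
Proof.
have [tau_bi tau_univ _] := hT; split.
  move=> [phi [phi_mor phi_r phi_l]].
  exact: (unital_bimorphism_boolean (bimorphism_comp tau_bi phi_mor)).
move=> bP; have [lat _ _] := bP.
(* The lattice property only asserts that meets exist; description turns them into a function, to
   which universality applies. *)
pose meet p q := sval (constructive_indefinite_description _ (lat p q).1).
have meetP p q : is_meet p q (meet p q)
  by rewrite /meet; case: constructive_indefinite_description.
have [phi phi_mor phiE] := tau_univ P meet (boolean_meet_bimorphism bP meetP).
(* Both unit laws say that the meet of [p] and [one] is [p]. *)
exists phi; split=> // p; rewrite -phiE; apply: is_meet_uniq (meetP _ _) _.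
- by split=> //; [apply: oa_le_refl|apply: oa_le1].
- by split=> //; [apply: oa_le1|apply: oa_le_refl].
Qed.
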